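(* Let $f:[0,1]\to\mathbb R$ be of class $C^1$ with $f(0)=f(1)=0$, $f>0$ in $(0,1)$ and $f'(0)=0$. Let $u_0:\mathbb R\to[0,1]$ be uniformly continuous with $u_0>0$ in $\mathbb R$, $\liminf_{x\to-\infty}u_0(x)>0$ and $\lim_{x\to+\infty}u_0(x)=0$. Let $u(t,x)$ be the solution of $\partial_t u=\partial_{xx}u+f(u)$ for $t>0$, $x\in\mathbb R$, with initial condition $u(0,\cdot)=u_0$, and let $E_\lambda(t)$, $\gamma$, $t_\lambda$ be as defined in the context. Let $\alpha>0$ and $\beta>1$ be such that $$\beta\geq 1+\frac1\alpha .$$ Assume that there are $C>0$ and $x_0>1$ such that $$u_0(x)\leq \frac{C}{x^\alpha},\quad \forall x\geq x_0.$$ Assume that there are $r>0$, $\delta>0$ and $s_0\in(0,1)$ such that $$f(s)\leq r s^\beta(1-s^\delta),\quad \forall\, 0\leq s\leq s_0.$$ Then there is a speed $c>0$ such that, for any $\lambda\in(0,1)$, there is a time $T_\lambda\geq t_\lambda$ such that $$\emptyset\neq E_\lambda(t)\subset(\gamma t,ct),\quad \forall t\geq T_\lambda.$$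
   Context: For $\lambda\in(0,1)$ and $t\geq 0$, $E_\lambda(t):=\{x\in\mathbb R:\ u(t,x)=\lambda\}$ denotes the $\lambda$-level set of $u(t,\cdot)$. Under the stated assumptions on $f$ and $u_0$ one has $0<u(t,x)<1$ for all $t>0$, $x\in\mathbb R$; there is $\gamma>0$ such that $\lim_{t\to\infty}\inf_{x\leq\gamma t}u(t,x)=1$; and $\lim_{x\to+\infty}u(t,x)=0$ for every $t\geq0$. Such a $\gamma>0$ is fixed. Consequently, for any $\lambda\in(0,1)$ there is a time $t_\lambda>0$, which is fixed, such that $\emptyset\neq E_\lambda(t)\subset(\gamma t,+\infty)$ for all $t\geq t_\lambda$. *)

(* Defs.v *)
From HB Require Import structures.
From mathcomp Require Import all_boot all_order all_algebra.
From mathcomp Require Import all_classical all_reals all_analysis.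

Set Implicit Arguments.
Unset Strict Implicit.
Unset Printing Implicit Defensive.

Import Order.TTheory GRing.Theory Num.Theory.
Import numFieldNormedType.Exports.

Local Open Scope ring_scope.
Local Open Scope classical_set_scope.

(* A function on [0, 1] is represented by a total function of which only the
   values on [0, 1] are used; its derivative is therefore the limit of the
   difference quotients taken inside [0, 1] (one-sided at 0 and 1). *)
Definition C1_on_unit_itv (R : realType) (f f' : R -> R) : Prop :=
  (forall s : R, 0 <= s <= 1 ->
     (f y - f s) / (y - s) @[y --> within (`[0, 1] `\ s) (nbhs s)] --> f' s) /\
  {within `[0, 1], continuous f'}.

(* Classical solutions, in C([0, +oo) x R) and C^{1,2}((0, +oo) x R), of
   u_t = u_xx + f(u) with u(0, .) = u0. The bounds 0 <= u <= 1 belong to the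
   notion of solution because f is only defined on [0, 1]. The values of u at
   negative times are irrelevant. *)
Record solves_cauchy (R : realType) (f u0 : R -> R) (u : R -> R -> R) : Prop :=
  SolvesCauchy {
    sol_range : forall t x : R, 0 <= t -> 0 <= u t x <= 1;
    sol_init : forall x : R, u 0 x = u0 x;
    sol_cont : {within [set p : R * R | 0 <= p.1],
                 continuous (fun p : R * R => u p.1 p.2)};
    sol_derivable_t : forall t x : R, 0 < t -> derivable (u ^~ x) t 1;
    sol_derivable_x : forall t x : R, 0 < t -> derivable (u t) x 1;
    sol_derivable_xx : forall t x : R, 0 < t -> derivable (u t)^`() x 1;
    sol_cont_t : forall t x : R, 0 < t ->
      {for (t, x), continuous (fun p : R * R => (u ^~ p.2)^`() p.1)};
    sol_cont_x : forall t x : R, 0 < t ->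
      {for (t, x), continuous (fun p : R * R => (u p.1)^`() p.2)};
    sol_cont_xx : forall t x : R, 0 < t ->
      {for (t, x), continuous (fun p : R * R => (u p.1)^`(2) p.2)};
    sol_eq : forall t x : R, 0 < t ->
      (u ^~ x)^`() t = (u t)^`(2)%classic x + f (u t x)
  }.

Definition level_set (R : realType) (u : R -> R -> R) (lambda t : R) : set R :=
  [set x | u t x = lambda].

(* Main.v *)
Require Import Defs.
From HB Require Import structures.
From mathcomp Require Import all_boot all_order all_algebra.
From mathcomp Require Import all_classical all_reals all_analysis.
From mathcomp Require Import ring lra.

Set Implicit Arguments.
Unset Strict Implicit.
Unset Printing Implicit Defensive.

Import Order.TTheory GRing.Theory Num.Theory.
Import numFieldNormedType.Exports.

Local Open Scope ring_scope.
Local Open Scope classical_set_scope.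

(** Level sets move at most linearly because the condition
    beta >= 1 + 1 / alpha makes a power tail travelling at constant speed a
    supersolution. For the profile w(z) = (a / z)^alpha in the moving variable
    z = x - c t, the transport term - c w'(z) has order z^(- alpha - 1). The
    diffusion term w''(z) has order z^(- alpha - 2), and the reaction term is
    at most rho w(z)^beta, of order z^(- alpha beta). Both are dominated by the
    transport term for z >= 1 once c is large, since alpha beta >= alpha + 1
    ([algebraic_supersolution]). The bound f(s) <= rho s^beta, assumed near 0
    only, extends to all of [0, 1] with a larger rho by boundedness of f
    ([nonlinearity_le_powR]).

    The profile takes the value 1 at z = a, so on the half-line x >= a + c t it
    dominates u on the lateral boundary because u <= 1, and at time 0 because
    of the decay of u0. Comparison there ([solution_le_moving_power]) follows
    from a maximum principle for bounded functions on this unbounded moving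
    domain ([parabolic_max_principle]), applied to u - w; the reaction
    difference is controlled where u > w by the Lipschitz bound for s^beta on
    [0, 1] ([powR_sub_le]).

    Finally, at x >= (c + 1) t one has z >= t, hence u <= (a / t)^alpha, which
    is below any given level lambda for t large: every speed above c will do. *)

(** * First and second derivatives at a maximum *)

Lemma is_derive_slope_gt0 (R : realType) (F : R -> R) (x d : R) :
  is_derive x 1 F d -> 0 < d ->
  \forall y \near x, y != x -> 0 < (F y - F x) / (y - x).
Proof.
move=> [dF Fd] d0.
have : h^-1 *: (F (h *: 1 + x) - F x) @[h --> 0^'] --> d.
  by rewrite -Fd; exact: dF.
move=> /cvgr_gt /(_ _ d0) /nbhs_ballP[e /= e0 He].
apply/nbhs_ballP; exists e => // y /= xy yx.
have := He (y - x); rewrite /ball/= sub0r normrN distrC => /(_ xy).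
rewrite subr_eq0 => /(_ yx).
by rewrite /GRing.scale/= mulr1 subrK mulrC.
Qed.

(** Only points on the left are compared: at a maximum over a time interval
    [0, T] reached at T itself, nothing is known about later times. *)
Lemma is_derive_ge0_at_left_max (R : realType) (F : R -> R) (x d : R) :
  is_derive x 1 F d -> (\forall y \near x, y < x -> F y <= F x) -> 0 <= d.
Proof.
move=> dF maxF; rewrite leNgt; apply/negP => d0.
have dNF : is_derive x 1 (- F) (- d) by exact: is_deriveN.
have Nd0 : 0 < - d by rewrite oppr_gt0.
have /nbhs_ballP[e /= e0 He] :
    \forall y \near x, (y < x -> F y <= F x) /\
      (y != x -> 0 < ((- F) y - (- F) x) / (y - x)).
  by near=> y; split; near: y => //; exact: is_derive_slope_gt0 dNF Nd0.
have [|Fle] := He (x - e / 2); first by rewrite /ball/= ltr_norml; lra.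
have {}Fle : F (x - e / 2) <= F x by apply: Fle; lra.
have ne : x - e / 2 != x by rewrite lt_eqF//; lra.
move=> /(_ ne); rewrite !fctE.
have -> : x - e / 2 - x = - (e / 2) by ring.
rewrite invrN mulrN -mulNr pmulr_lgt0 ?invr_gt0 ?divr_gt0//.
lra.
Unshelve. all: by end_near. Qed.

(** If the second derivative were positive at a maximum, the first derivative,
    which vanishes there, would be positive just to the right, and the mean
    value theorem would give a larger value. *)
Lemma is_derive2_le0_at_max (R : realType) (F F1 : R -> R) (x d : R) :
  (\forall y \near x, is_derive (y : R) 1 F (F1 y)) -> is_derive x 1 F1 d ->
  (\forall y \near x, F y <= F x) -> d <= 0.
Proof.
move=> dF dF1 maxF; rewrite leNgt; apply/negP => d0.
have /nbhs_ballP[e /= e0 He] : \forall y \near x,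
    is_derive (y : R) 1 F (F1 y) /\ F y <= F x /\ (y != x -> 0 < (F1 y - F1 x) / (y - x)).
  near=> y; split; first by near: y.
  by split; near: y => //; exact: is_derive_slope_gt0 dF1 d0.
have inb y : x - e < y < x + e -> ball x e y.
  by move=> ?; rewrite /ball/= ltr_norml; lra.
have F1x : F1 x = 0.
  have xe : x - e <= x + e by lra.
  have xin : x \in `](x - e), (x + e)[%R by rewrite in_itv/=; lra.
  have [| |_ <-] := @derive1_at_max _ F _ _ _ xe _ xin.
  - by move=> y; rewrite in_itv/= => /inb /He[[]].
  - by move=> y; rewrite in_itv/= => /inb /He[_ []].
  - have [|[_ ->]] := He x; [by apply: inb; lra|by []].
pose y := x + e / 2.
have [|z | | z zin Fyx] := @MVT _ F F1 x y.
- by rewrite /y; lra.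
- by rewrite in_itv/= /y => zin; have [|//] := He z; apply: inb; lra.
- apply: derivable_within_continuous => z; rewrite in_itv/= /y => zin.
  by have [|[]//] := He z; apply: inb; lra.
move: zin; rewrite in_itv/= => /andP[xz zy].
have [|_ [_]] := He z; first by apply: inb; rewrite /y in zy; lra.
rewrite gt_eqF// => /(_ isT); rewrite F1x subr0.
rewrite pmulr_lgt0 ?invr_gt0 ?subr_gt0// => F1z.
have [|_ [+ _]] := He y; first by apply: inb; rewrite /y; lra.
rewrite leNgt => /negP; apply; rewrite -subr_gt0 Fyx mulr_gt0// /y; lra.
Unshelve. all: by end_near. Qed.

(** * Maximum principle on a moving half-line *)

Lemma is_derive_affine (R : realType) (k b t : R) :
  is_derive t 1 (fun s => b + k * s) k.
Proof.
have H := is_deriveD (is_derive_cst b t 1) (is_deriveZ k (is_derive_id t 1)).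
by apply: (is_derive_eq H); rewrite add0r /GRing.scale/= mulr1.
Qed.

(** The domain is unbounded, so a maximum need not exist. Multiplying v by
    exp (- L t) absorbs the zeroth-order term, and subtracting a small multiple
    eps of q = 1 + x^2 + 3 t makes the result G negative for large x, since v
    is bounded; thus a positive value of G forces a positive maximum on a
    compact set. It lies off the initial time and the moving boundary, where
    v <= 0, so there G_t >= 0 >= G_xx. This contradicts the inequality for v,
    because q_t - q_xx = 1 > 0. *)
Lemma parabolic_max_principle (R : realType) (v vt vx vxx : R -> R -> R)
    (a c L B : R) :
  0 <= L ->
  {within [set p : R * R | 0 <= p.1 /\ a + c * p.1 <= p.2],
    continuous (fun p : R * R => v p.1 p.2)} ->
  (forall t x, 0 <= t -> a + c * t <= x -> v t x <= B) ->
  (forall x, a <= x -> v 0 x <= 0) ->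
  (forall t, 0 <= t -> v t (a + c * t) <= 0) ->
  (forall t x, 0 < t -> a + c * t < x ->
    [/\ is_derive (t : R) 1 (v ^~ x) (vt t x),
        is_derive (x : R) 1 (v t) (vx t x) &
        is_derive (x : R) 1 (vx t) (vxx t x)]) ->
  (forall t x, 0 < t -> a + c * t < x -> 0 < v t x ->
    vt t x - vxx t x <= L * v t x) ->
  forall t x, 0 <= t -> a + c * t <= x -> v t x <= 0.
Proof.
move=> L0 vcont vB v_init v_bd dv v_sub T y T0 Ty.
rewrite leNgt; apply/negP => vpos.
pose q (t x : R) : R := 1 + x ^+ 2 + 3 * t.
have q_gt0 t x : 0 <= t -> 0 < q t x by move=> t0; rewrite /q; nra.
(* This eps makes the penalty at (T, y) half of the value of exp (- L T) * v. *)
pose eps := expR (- L * T) * v T y / (2 * q T y).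
have eps0 : 0 < eps.
  by rewrite /eps divr_gt0 ?mulr_gt0 ?expR_gt0 ?q_gt0.
pose G t x := expR (- L * t) * v t x - eps * q t x.
have GTy : 0 < G T y.
  have : eps * q T y = expR (- L * T) * v T y / 2.
    by rewrite /eps; field; rewrite gt_eqF// q_gt0.
  rewrite /G => ->.
  have : 0 < expR (- L * T) * v T y by rewrite mulr_gt0 ?expR_gt0.
  by lra.
pose X := `|y| + `|B| / eps + 1.
have Gpos_lt t x : 0 <= t -> a + c * t <= x -> 0 < G t x -> `|x| < X.
  move=> t0 tx Gp; rewrite ltNge; apply/negP => Xx.
  have e1 : expR (- L * t) <= 1.
    by rewrite -expR0 ler_expR mulNr oppr_le0 mulr_ge0.
  have vle : expR (- L * t) * v t x <= `|B|.
    apply: (@le_trans _ _ (expR (- L * t) * `|B|)).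
      rewrite ler_pM2l ?expR_gt0//.
      by apply: le_trans (ler_norm B); exact: vB.
    by rewrite ler_piMl.
  have Bx : `|B| < eps * `|x|.
    rewrite mulrC -ltr_pdivrMr//; apply: lt_le_trans Xx.
    by rewrite /X; have := normr_ge0 y; lra.
  (* |x| <= 1 + x^2 turns the quadratic penalty into a linear one. *)
  have xq : `|x| <= q t x.
    by rewrite /q -(real_normK (num_real x)); nra.
  have : eps * `|x| <= eps * q t x by rewrite ler_pM2l.
  by move: Gp; rewrite /G; lra.
pose D := [set p : R * R | 0 <= p.1 /\ a + c * p.1 <= p.2].
pose K := (`[0, T] `*` `[- X, X]) `&` [set p : R * R | a + c * p.1 <= p.2].
have KD : K `<=` D.
  by move=> [t x] [[/= + _]]; rewrite in_itv/= => /andP[t0 _] tx; split.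
have Kcpt : compact K.
  apply: compact_closedI.
    by apply: compact_setX; exact: segment_compact.
  have -> : [set p : R * R | a + c * p.1 <= p.2] =
            (fun p : R * R => a + c * p.1 - p.2) @^-1` [set z | z <= 0].
    by apply/seteqP; split => p /=; rewrite subr_le0.
  apply: preimage_closed; last exact: closed_le.
  move=> p _; apply: cvgB; last exact: cvg_snd.
  apply: cvgD; first exact: cvg_cst.
  by apply: cvgM; [exact: cvg_cst|exact: cvg_fst].
have Gcont : {within K, continuous (fun p : R * R => G p.1 p.2)}.
  apply: (continuous_subspaceW KD) => p.
  have fstc : {within D, continuous (fun p : R * R => p.1)}.
    by apply: continuous_subspaceT => z; exact: cvg_fst.
  have sndc : {within D, continuous (fun p : R * R => p.2)}.
    by apply: continuous_subspaceT => z; exact: cvg_snd.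
  apply: cvgB.
    apply: cvgM; last exact: vcont.
    apply: continuous_comp; last exact: continuous_expR.
    by apply: cvgM; [exact: cvg_cst|exact: fstc].
  apply: cvgM; first exact: cvg_cst.
  apply: cvgD; last by apply: cvgM; [exact: cvg_cst|exact: fstc].
  apply: cvgD; first exact: cvg_cst.
  by apply: cvgM; exact: sndc.
have yX : `|y| < X by apply: Gpos_lt GTy.
have KTy : K (T, y).
  split => //=; split; rewrite /= in_itv/= ?T0 ?lexx//.
  by rewrite -ler_norml ltW.
have [[t x] /set_mem[[/= + _] tx] Gmax] :=
  compact_EVT_max (ex_intro _ _ KTy) Kcpt Gcont.
rewrite in_itv/= => /andP[t0 tT].
have {}Gmax s z : 0 <= s <= T -> a + c * s <= z -> `|z| <= X -> G s z <= G t x.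
  move=> sT sz zX; apply: (Gmax (s, z)); apply/mem_set.
  by split => //=; split; rewrite /= in_itv//= -ler_norml.
have Gtx : 0 < G t x.
  by apply: lt_le_trans GTy (Gmax _ _ _ _ _); rewrite ?T0 ?lexx// ltW.
have xX := Gpos_lt _ _ t0 tx Gtx.
have vtx : 0 < v t x.
  have : 0 < expR (- L * t) * v t x.
    by move: Gtx; rewrite /G; have := mulr_gt0 eps0 (q_gt0 t x t0); lra.
  by rewrite pmulr_rgt0 ?expR_gt0.
have {}t0 : 0 < t.
  rewrite lt_neqAle t0 andbT; apply/eqP => t00.
  move: vtx; rewrite ltNge -t00 => /negP; apply; apply: v_init.
  by rewrite -t00 mulr0 addr0 in tx.
have {}tx : a + c * t < x.
  rewrite lt_neqAle tx andbT; apply/eqP => xE.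
  by move: vtx; rewrite ltNge -xE => /negP; apply; apply: v_bd; exact: ltW.
have dGt : is_derive t 1 (G ^~ x)
    (expR (- L * t) * (vt t x - L * v t x) - 3 * eps).
  have [dvt _ _] := dv t x t0 tx.
  have dE : is_derive t 1 (fun s => expR (- L * s)) (expR (- L * t) * - L).
    apply: is_derive1_comp.
    by have := is_derive_affine (- L) 0 t; under eq_fun do rewrite add0r.
  have dq : is_derive t 1 (q ^~ x) 3 by exact: is_derive_affine.
  apply: (is_derive_eq (is_deriveB (is_deriveM dE dvt) (is_deriveZ eps dq))).
  by rewrite /GRing.scale/=; ring.
pose Gx s z := expR (- L * s) * vx s z - eps * (2 * z).
have dGx z : a + c * t < z -> is_derive z 1 (G t) (Gx t z).
  move=> tz; have [_ dvx _] := dv t z t0 tz.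
  have dq : is_derive z 1 (q t) (2 * z).
    have -> : q t = (fun z => (1 + 3 * t) + z * z).
      by apply/funext => w; rewrite /q; ring.
    apply: (is_derive_eq (is_deriveD (is_derive_cst (1 + 3 * t) z 1)
      (is_deriveM (is_derive_id z 1) (is_derive_id z 1)))).
    by rewrite /GRing.scale/=; ring.
  apply: (is_derive_eq (is_deriveB (is_deriveZ (expR (- L * t)) dvx)
    (is_deriveZ eps dq))).
  by rewrite /GRing.scale/=.
have dGxx : is_derive x 1 (Gx t) (expR (- L * t) * vxx t x - 2 * eps).
  have [_ _ dvxx] := dv t x t0 tx.
  apply: (is_derive_eq (is_deriveB (is_deriveZ (expR (- L * t)) dvxx)
    (is_deriveZ eps (is_deriveZ 2 (is_derive_id x 1))))).
  by rewrite /GRing.scale/=; ring.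
(* Near the maximum the earlier points (s, x) stay in the domain, since the
   moving boundary is continuous; this works for either sign of c. *)
have Gt_ge0 : 0 <= expR (- L * t) * (vt t x - L * v t x) - 3 * eps.
  apply: is_derive_ge0_at_left_max dGt _.
  have cts : (fun s : R => a + c * s) @ t --> a + c * t.
    apply: cvgD; first exact: cvg_cst.
    by apply: cvgM; [exact: cvg_cst|exact: cvg_id].
  near=> s => st; apply: Gmax; last exact: ltW.
    apply/andP; split; last by lra.
    by apply: ltW; near: s; exact: lt_nbhsr.
  by apply: ltW; near: s; move/cvgr_lt : cts; exact.
have Gxx_le0 : expR (- L * t) * vxx t x - 2 * eps <= 0.
  apply: is_derive2_le0_at_max dGxx _.
    by near=> z; apply: dGx; near: z; exact: lt_nbhsr.
  near=> z; apply: Gmax.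
  - by rewrite ltW.
  - by apply: ltW; near: z; exact: lt_nbhsr.
  - apply: ltW; near: z.
    have /cvgr_lt : (fun z : R => `|z|) @ x --> `|x| by exact: norm_continuous.
    exact.
have : expR (- L * t) * (vt t x - vxx t x) <= expR (- L * t) * (L * v t x).
  by rewrite ler_pM2l ?expR_gt0//; exact: v_sub.
by nra.
Unshelve. all: by end_near. Qed.

(** * Bounds on the reaction term *)

(** Difference quotients that converge at s are bounded near s, so
    g y - g s = O(y - s) inside A. *)
Lemma slope_cvg_continuous (R : realType) (A : set R) (g g' : R -> R) :
  (forall s, A s ->
    (g y - g s) / (y - s) @[y --> within (A `\ s) (nbhs s)] --> g' s) ->
  {within A, continuous g}.
Proof.
move=> dg; apply/subspace_continuousP => s As.
apply/cvgrPdist_le => e e0.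
have Ms : `|g' s| < `|g' s| + 1 by rewrite ltrDl.
have M0 : 0 < `|g' s| + 1 by rewrite ltr_wpDl.
have /cvgr_norm_lt/(_ _ Ms) := dg s As.
rewrite !near_withinE => sl; near=> y => Ay.
have [->|ys] := eqVneq y s; first by rewrite subrr normr0 ltW.
have ys0 : y - s != 0 by rewrite subr_eq0.
have : `|(g y - g s) / (y - s)| < `|g' s| + 1.
  have : (A `\ s) y by split => //=; apply/eqP.
  by near: y.
rewrite normrM normfV ltr_pdivrMr ?normr_gt0// => gle.
rewrite distrC; apply: (le_trans (ltW gle)).
rewrite mulrC -ler_pdivlMr// distrC; near: y.
by apply: (@cvgr_dist_le _ _ _ _ _ idfun); [exact: cvg_id|rewrite divr_gt0].
Unshelve. all: by end_near. Qed.

(** On (0, 1] the derivative b x^(b - 1) of x^b is at most b. *)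
Lemma powR_sub_le (R : realType) (b w s : R) :
  1 <= b -> 0 < w -> w <= s -> s <= 1 -> s `^ b - w `^ b <= b * (s - w).
Proof.
move=> b1 w0 ws s1.
have dpow (x : R) : 0 < x -> is_derive x 1 (@powR R ^~ b) (b * x `^ (b - 1)).
  exact: is_derive1_powR.
have [|| x] := @MVT_segment _ (@powR R ^~ b) (fun x => b * x `^ (b - 1)) w s ws.
- by move=> x; rewrite in_itv/= => /andP[wx _]; apply: dpow; exact: lt_trans wx.
- apply: derivable_within_continuous => x; rewrite in_itv/= => /andP[wx _].
  by have [] := dpow x (lt_le_trans w0 wx).
rewrite in_itv/= => /andP[wx xs] ->.
rewrite ler_wpM2r ?subr_ge0// ler_piMr//; first by lra.
have x0 : 0 < x by exact: lt_le_trans wx.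
have {2}<- := powRr0 x.
by apply: ger_powR; rewrite ?subr_ge0// x0 (le_trans xs).
Qed.

(** Away from 0 the power s^b is at least s0^b, so the maximum of f on [0, 1]
    divided by s0^b takes care of the values s > s0. *)
Lemma nonlinearity_le_powR (R : realType) (f : R -> R) (b r s0 : R) :
  {within `[0, 1], continuous f} -> f 0 = 0 -> 0 <= b -> 0 < r -> 0 < s0 ->
  (forall s, 0 <= s <= s0 -> f s <= r * s `^ b) ->
  exists2 rho : R, 0 < rho & forall s, 0 <= s <= 1 -> f s <= rho * s `^ b.
Proof.
move=> fc f0 b0 r0 s00 fs0.
have [m _ fm] := EVT_max ler01 fc.
have fm0 : 0 <= f m by rewrite -f0; apply: fm; rewrite in_itv/= lexx ler01.
have s0b : 0 < s0 `^ b by exact: powR_gt0.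
exists (r + f m / s0 `^ b); first by rewrite ltr_pwDl// divr_ge0// ltW.
move=> s /andP[s_ge0 s1]; rewrite mulrDl.
have [ss0|s0s] := leP s s0.
  by rewrite ler_wpDr ?fs0 ?s_ge0// mulr_ge0 ?divr_ge0 ?powR_ge0// ltW.
rewrite ler_wpDl ?mulr_ge0 ?powR_ge0 ?(ltW r0)//.
apply: (@le_trans _ _ (f m)); first by apply: fm; rewrite in_itv/= s_ge0.
rewrite mulrAC -mulrA ler_peMr// ler_pdivlMr// mul1r.
by apply: ge0_ler_powR; rewrite ?nnegrE// ltW.
Qed.

(** * Comparison with a travelling power profile *)

Lemma derivable_is_derive (R : realType) (g : R -> R) (x : R) :
  derivable g x 1 -> is_derive x 1 g (g^`() x).
Proof. by move=> dg; rewrite derive1E; exact: derivableP. Qed.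

Lemma is_derive_scaled_powR (R : realType) (k e z : R) : 0 < z ->
  is_derive z 1 (fun y => k * y `^ e) (k * e * z `^ (e - 1)).
Proof.
move=> z0; rewrite -mulrA.
exact: (is_deriveZ k (is_derive1_powR e z0)).
Qed.

(** With w(z) = K z^(- alpha), this is w'' + rho w^beta <= - c w'. All three
    terms are compared with z^(- alpha - 1): the summand alpha + 1 of c pays
    for diffusion and the summand with rho pays for reaction. *)
Lemma algebraic_supersolution (R : realType) (alpha beta K rho c z : R) :
  0 < alpha -> 1 + 1 / alpha <= beta -> 0 < K -> 0 <= rho -> 1 <= z ->
  c = alpha + 1 + rho * K `^ (beta - 1) / alpha ->
  K * (- alpha) * (- alpha - 1) * z `^ (- alpha - 1 - 1) +
    rho * (K * z `^ (- alpha)) `^ beta <=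
  - c * (K * (- alpha) * z `^ (- alpha - 1)).
Proof.
move=> al0 alb K0 rho0 z1 cE.
have ab : alpha + 1 <= alpha * beta.
  have -> : alpha + 1 = alpha * (1 + 1 / alpha) by field; rewrite gt_eqF.
  by rewrite ler_pM2l.
have z2 : z `^ (- alpha - 1 - 1) <= z `^ (- alpha - 1).
  by apply: ler_powR => //; lra.
have zb : z `^ (- alpha * beta) <= z `^ (- alpha - 1).
  by apply: ler_powR => //; lra.
rewrite powRM ?powR_ge0 ?(ltW K0)// -powRrM.
have -> : K `^ beta = K * K `^ (beta - 1).
  rewrite mulr_powRB1 ?ltW//; apply: lt_le_trans alb.
  by rewrite addr_gt0// divr_gt0.
have := powR_gt0 (beta - 1) K0.
move: zb z2 cE.
set P := K `^ (beta - 1); set Z := z `^ (- alpha - 1).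
set Z2 := z `^ (- alpha - 1 - 1); set Zb := z `^ (- alpha * beta).
move=> ZbZ Z2Z cE P0.
have -> : - c * (K * - alpha * Z) =
    K * alpha * (alpha + 1) * Z + rho * (K * P * Z).
  by rewrite cE; field; rewrite gt_eqF.
have -> : K * - alpha * (- alpha - 1) = K * alpha * (alpha + 1) by ring.
apply: lerD.
  by rewrite ler_wpM2l// !mulr_ge0 ?(ltW K0) ?(ltW al0)//; lra.
by rewrite !ler_wpM2l// mulr_ge0 ?(ltW K0) ?(ltW P0).
Qed.

(** The constant a^alpha normalises the profile to the value 1 at z = a, which
    is what makes it dominate any solution on the moving boundary
    x = a + c t. *)
Lemma solution_le_moving_power (R : realType) (f u0 : R -> R) (u : R -> R -> R)
    (alpha beta a rho c : R) :
  solves_cauchy f u0 u ->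
  0 < alpha -> 1 + 1 / alpha <= beta -> 1 <= a -> 0 <= rho ->
  (forall s, 0 <= s <= 1 -> f s <= rho * s `^ beta) ->
  (forall x, a <= x -> u0 x <= a `^ alpha * x `^ (- alpha)) ->
  c = alpha + 1 + rho * (a `^ alpha) `^ (beta - 1) / alpha ->
  forall t x, 0 <= t -> a + c * t <= x ->
    u t x <= a `^ alpha * (x - c * t) `^ (- alpha).
Proof.
move=> us al0 alb a1 rho0 frho u0a cE t x t0 tx.
have a0 : 0 < a by exact: lt_le_trans a1.
have b1 : 1 <= beta.
  by apply: le_trans alb; rewrite lerDl divr_ge0// ltW.
set K := a `^ alpha in u0a cE *.
have K0 : 0 < K by exact: powR_gt0.
have w_a : K * a `^ (- alpha) = 1 by rewrite powRN divff// gt_eqF.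
pose w0 z := K * z `^ (- alpha).
pose w1 z := K * - alpha * z `^ (- alpha - 1).
pose w2 z := K * - alpha * (- alpha - 1) * z `^ (- alpha - 1 - 1).
have dw0 (z : R) : 0 < z -> is_derive z 1 w0 (w1 z).
  by exact: is_derive_scaled_powR.
have dw1 (z : R) : 0 < z -> is_derive z 1 w1 (w2 z).
  by exact: is_derive_scaled_powR.
have w_le1 z : a <= z -> w0 z <= 1.
  move=> az; have z0 : 0 < z by exact: lt_le_trans az.
  rewrite -w_a ler_pM2l// !powRN lef_pV2 ?posrE ?powR_gt0//.
  by apply: ge0_ler_powR; rewrite ?nnegrE ?(ltW al0) ?(ltW a0) ?(ltW z0).
rewrite -subr_le0.
pose v s y := u s y - w0 (y - c * s).
pose vt s y := derive1 (u ^~ y) s - - c * w1 (y - c * s).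
pose vx s y := derive1 (u s) y - w1 (y - c * s).
pose vxx s y := derive1 (derive1 (u s)) y - w2 (y - c * s).
apply: (@parabolic_max_principle _ v vt vx vxx a c (rho * beta) 1) => //.
- by rewrite mulr_ge0// (le_trans ler01).
- have uc := continuous_subspaceW _ (sol_cont us).
  have {uc}uc : {within [set p : R * R | 0 <= p.1 /\ a + c * p.1 <= p.2],
      continuous (fun p : R * R => u p.1 p.2)} by apply: uc => p [].
  have wc : {within [set p : R * R | 0 <= p.1 /\ a + c * p.1 <= p.2],
      continuous (fun p : R * R => w0 (p.2 - c * p.1))}.
    apply: continuous_in_subspaceT => p /set_mem[p0 pa].
    apply: (@continuous_comp _ _ _ (fun p : R * R => p.2 - c * p.1) w0).
      apply: cvgB; first exact: cvg_snd.
      by apply: cvgM; [exact: cvg_cst|exact: cvg_fst].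
    apply: differentiable_continuous; apply/derivable1_diffP.
    by have [] := dw0 (p.2 - c * p.1) _; first by lra.
  by move=> p; apply: cvgB; [exact: uc|exact: wc].
- move=> s y s0 sy; have /andP[_ u1] := sol_range us y s0.
  apply: le_trans u1; rewrite gerDl oppr_le0 mulr_ge0 ?powR_ge0//; exact: ltW.
- move=> y ay; rewrite /v mulr0 subr0 subr_le0 (sol_init us).
  exact: u0a.
- move=> s s0; rewrite /v addrK /w0 w_a subr_le0.
  by have /andP[] := sol_range us (a + c * s) s0.
- move=> s y s0 sy.
  have z0 : 0 < y - c * s by lra.
  have shift (z : R) : is_derive z 1 (fun y => y - c * s) 1.
    have := is_derive_affine 1 (- (c * s)) z.
    by under eq_fun do rewrite mul1r addrC.
  have dux := derivable_is_derive (@sol_derivable_x _ _ _ _ us s y s0).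
  have duxx := derivable_is_derive (@sol_derivable_xx _ _ _ _ us s y s0).
  have dut := derivable_is_derive (@sol_derivable_t _ _ _ _ us s y s0).
  split.
  + apply: is_deriveB; rewrite mulrC.
    apply: (@is_derive1_comp _ w0 (fun s => y - c * s)); first exact: dw0.
    have := is_derive_affine (- c) y s.
    by under eq_fun do rewrite mulNr.
  + apply: is_deriveB; rewrite -[w1 _]mulr1.
    by apply: (@is_derive1_comp _ w0 (fun y => y - c * s)); first exact: dw0.
  + apply: is_deriveB; rewrite -[w2 _]mulr1.
    by apply: (@is_derive1_comp _ w1 (fun y => y - c * s)); first exact: dw1.
- move=> s y s0 sy; rewrite /v subr_gt0 => wu.
  have za : a <= y - c * s by lra.
  have /andP[u_ge0 u_le1] := sol_range us y (ltW s0).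
  have w_gt0 : 0 < w0 (y - c * s).
    by rewrite mulr_gt0// powR_gt0// (lt_le_trans a0).
  have sup : w2 (y - c * s) + rho * w0 (y - c * s) `^ beta <=
      - c * w1 (y - c * s).
    by apply: algebraic_supersolution => //; exact: le_trans za.
  have lip := powR_sub_le b1 w_gt0 (ltW wu) u_le1.
  have {}lip := ler_wpM2l rho0 lip.
  have fu : f (u s y) <= rho * u s y `^ beta by apply: frho; rewrite u_ge0.
  have := sol_eq us y s0; rewrite /vt /vxx => ->.
  have -> : ((u s)^`(2))%classic y = derive1 (derive1 (u s)) y by [].
  move: (derive1 _ y) sup lip fu => uxx.
  lra.
Qed.

(** * Linear upper bound on the level sets *)

Theorem theorem2p3 (R : realType)
  (f f' : R -> R)
  (f_C1 : C1_on_unit_itv f f')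
  (f_0 : f 0 = 0) (f_1 : f 1 = 0)
  (f_pos : forall s : R, 0 < s < 1 -> 0 < f s)
  (f'_0 : f' 0 = 0)
  (u0 : R -> R)
  (u0_range : forall x : R, 0 <= u0 x <= 1)
  (u0_unif : unif_continuous u0)
  (u0_pos : forall x : R, 0 < u0 x)
  (u0_liminf : (0 < limf_einf (fun x : R => (u0 x)%:E) (ninfty_nbhs R))%E)
  (u0_lim : u0 x @[x --> +oo] --> (0 : R))
  (u : R -> R -> R)
  (u_sol : solves_cauchy f u0 u)
  (gamma : R) (gamma_pos : 0 < gamma)
  (gamma_lim :
     inf [set u t x | x in [set x : R | x <= gamma * t]] @[t --> +oo]
       --> (1 : R))
  (t_ : R -> R)
  (t_spec : forall lambda : R, 0 < lambda < 1 ->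
     0 < t_ lambda /\
     forall t : R, t_ lambda <= t ->
       level_set u lambda t !=set0 /\
       level_set u lambda t `<=` `]gamma * t, +oo[)
  (alpha beta : R) (alpha_pos : 0 < alpha) (beta_gt1 : 1 < beta)
  (alpha_beta : 1 + 1 / alpha <= beta)
  (C x0 : R) (C_pos : 0 < C) (x0_gt1 : 1 < x0)
  (u0_tail : forall x : R, x0 <= x -> u0 x <= C / x `^ alpha)
  (r delta s0 : R) (r_pos : 0 < r) (delta_pos : 0 < delta)
  (s0_range : 0 < s0 < 1)
  (f_bound : forall s : R, 0 <= s <= s0 ->
     f s <= r * s `^ beta * (1 - s `^ delta)) :
  exists2 c : R, 0 < c &
    forall lambda : R, 0 < lambda < 1 ->
      exists2 T : R, t_ lambda <= T &
        forall t : R, T <= t ->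
          level_set u lambda t !=set0 /\
          level_set u lambda t `<=` `]gamma * t, c * t[.
Proof.
have x0_gt0 : 0 < x0 by exact: lt_trans x0_gt1.
have beta_ge0 : 0 <= beta by lra.
have fc : {within `[0, 1], continuous f}.
  by apply: (@slope_cvg_continuous _ _ _ f') => s; rewrite /= in_itv => /f_C1.1.
have [rho rho0 frho] : exists2 rho : R, 0 < rho &
    forall s, 0 <= s <= 1 -> f s <= rho * s `^ beta.
  have /andP[s00 _] := s0_range.
  apply: (nonlinearity_le_powR fc f_0 beta_ge0 r_pos s00) => s sin.
  apply: le_trans (f_bound s sin) _.
  by rewrite ler_piMr ?gerBl ?powR_ge0// mulr_ge0 ?powR_ge0// ltW.
have [a x0a Ca] : exists2 a, x0 <= a & C <= a `^ alpha.
  exists (Num.max x0 (C `^ (1 / alpha))); first by rewrite le_max lexx.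
  have {1}-> : C = (C `^ (1 / alpha)) `^ alpha.
    by rewrite -powRrM divfK ?gt_eqF// powRr1// ltW.
  apply: ge0_ler_powR; rewrite ?nnegrE ?powR_ge0 ?(ltW alpha_pos)//.
    by rewrite le_max ltW.
  by rewrite le_max lexx orbT.
have a_ge1 : 1 <= a by lra.
have a0 : 0 < a by lra.
have u0a x : a <= x -> u0 x <= a `^ alpha * x `^ (- alpha).
  move=> ax; apply: le_trans (u0_tail x (le_trans x0a ax)) _.
  by rewrite powRN ler_wpM2r// invr_ge0 powR_ge0.
pose c0 := alpha + 1 + rho * (a `^ alpha) `^ (beta - 1) / alpha.
have c0_gt0 : 0 < c0.
  have : 0 <= rho * (a `^ alpha) `^ (beta - 1) / alpha.
    by rewrite divr_ge0 ?mulr_ge0 ?powR_ge0// ltW.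
  by rewrite /c0; lra.
have uw := solution_le_moving_power u_sol alpha_pos alpha_beta a_ge1 (ltW rho0)
  frho u0a (erefl c0).
clearbody c0; exists (c0 + 1); first by lra.
move=> lambda lambda01; have /andP[lambda0 _] := lambda01.
have [t_gt0 t_level] := t_spec lambda lambda01.
(* When z `^ alpha >= 2 a `^ alpha / lambda, the barrier is at most
   lambda / 2 at distance z from the moving origin c0 * t. *)
pose Z := a * (2 / lambda) `^ (1 / alpha).
exists (Num.max (t_ lambda) (Num.max a Z)); first by rewrite le_max lexx.
move=> t; rewrite !ge_max => /and3P[tt at_ Zt].
have [ne sub] := t_level t tt; split=> // x xlam.
have := sub x xlam; rewrite /= !in_itv/= => /andP[-> _] /=.
rewrite ltNge; apply/negP => cx.
have t0 : 0 <= t by lra.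
have zt : t <= x - c0 * t by lra.
have := uw t x t0; rewrite xlam.
have xz : a + c0 * t <= x by lra.
move=> /(_ xz); set z := x - c0 * t in zt *.
have Z_gt0 : 0 < Z by rewrite mulr_gt0 ?powR_gt0// divr_gt0.
have z_gt0 : 0 < z by lra.
have : Z `^ alpha <= z `^ alpha.
  by apply: ge0_ler_powR; rewrite ?nnegrE ?(ltW alpha_pos) ?(ltW Z_gt0)
    ?(ltW z_gt0) ?(le_trans Zt).
rewrite /Z powRM ?powR_ge0 ?(ltW a0)// -powRrM divfK ?gt_eqF//.
rewrite powRr1 ?divr_ge0 ?(ltW lambda0)//.
have A0 := powR_gt0 alpha a0; have z0 := powR_gt0 alpha z_gt0.
rewrite powRN mulrA ler_pdivrMr// ler_pdivlMr// => h1 h2; lra.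
Qed.
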